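(* Let $\phi:\mathbb{N}\to(0,1)$ be a monotone function decreasing to zero, and let $\mu$ be the infinite convolution $$\mu=\mathop{\ast}_{n=1}^{\infty}\left(\tfrac12(1+\phi(n))\,\delta_0+\tfrac12(1-\phi(n))\,\delta_{2^{-n}}\right).$$ (1) If $\dfrac{\phi(n)}{\phi(n+1)}<2$ for every $n$, then there is a constant $\gamma_1\in(0,1)$ depending only on $\phi$ such that $|\widehat{\mu}(t)|=O\big(\phi(\lceil\gamma_1\log_2|t|\rceil)\big)$ as $|t|\to\infty$. (2) If $\dfrac{\phi(n)}{\phi(n+1)}\ge 2$ for every $n$, then there is a constant $\gamma_2\in(0,1)$ depending only on $\phi$ such that $|\widehat{\mu}(t)|=O(|t|^{-\gamma_2})$ as $|t|\to\infty$.
   Context: $\mathbb{N}=\{1,2,3,\dots\}$; $\delta_x$ is the Dirac measure at $x$. The measure $\mu$ is the distribution of the random sum $S=\sum_{n\ge1}X_n2^{-n}$, where the $X_n$ are independent random variables with $P(X_n=0)=\tfrac12(1+\phi(n))$ and $P(X_n=1)=\tfrac12(1-\phi(n))$. The Fourier-Stieltjes transform of a Borel probability measure $\mu$ on $\mathbb{R}$ is $\widehat{\mu}(t)=\int_{\mathbb{R}}e^{2\pi itx}\,d\mu(x)$, $t\in\mathbb{R}$. $\lceil x\rceil$ denotes the smallest integer larger than $x$. *)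

(* Defs.v *)
From HB Require Import structures.
From mathcomp Require Import all_boot all_order all_algebra.
From mathcomp Require Import complex.
From mathcomp Require Import all_classical all_reals all_analysis.
From mathcomp Require Import measurable_realfun.

Set Implicit Arguments.
Unset Strict Implicit.
Unset Printing Implicit Defensive.

Import Order.TTheory GRing.Theory Num.Theory.
Import numFieldNormedType.Exports.

Local Open Scope classical_set_scope.
Local Open Scope ring_scope.

Section convolution.
Context {R : realType}.

Definition addRR (z : measurableTypeR R * measurableTypeR R) :
  measurableTypeR R := z.1 + z.2.

Let measurable_addRR : measurable_fun setT addRR.
Proof. exact: measurable_funD. Qed.

HB.instance Definition _ :=
  isMeasurableFun.Build _ _ _ _ addRR measurable_addRR.

Definition convolution (mu nu : probability (measurableTypeR R) R) :
  probability (measurableTypeR R) R := distribution (mu \x nu)%E addRR.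

(* The convolution of nu 1, ..., nu N; the value nu 0 is not used. *)
Fixpoint finite_convolution
    (nu : nat -> probability (measurableTypeR R) R) (N : nat) :
    probability (measurableTypeR R) R :=
  if N is M.+1 then convolution (finite_convolution nu M) (nu M.+1)
  else \d_(0 : measurableTypeR R).

Definition weakly_converges (mu_ : nat -> probability (measurableTypeR R) R)
    (mu : probability (measurableTypeR R) R) : Prop :=
  forall f : R -> R, continuous f -> (exists M, forall x, `|f x| <= M) ->
    (\int[mu_ n]_x f x)%R @[n --> \oo] --> (\int[mu]_x f x)%R.

(* mu is the infinite convolution of nu 1, nu 2, ...: the (unique) weak limit
   of the finite convolutions. *)
Definition is_infinite_convolution
    (nu : nat -> probability (measurableTypeR R) R)
    (mu : probability (measurableTypeR R) R) : Prop :=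
  weakly_converges (finite_convolution nu) mu.

End convolution.

Section two_point.
Context {R : realType}.
Variables (p : {itv R & `]0, 1[}) (a : R).

Definition two_point : set (measurableTypeR R) -> \bar R :=
  measure_add
    (mscale (2^-1 * (1 + p%:num))%:nng \d_(0 : measurableTypeR R))
    (mscale (2^-1 * (1 - p%:num))%:nng \d_(a : measurableTypeR R)).

HB.instance Definition _ := Measure.on two_point.

Lemma two_pointE (A : set (measurableTypeR R)) :
  two_point A = ((2^-1 * (1 + p%:num))%:E * \d_(0%R : measurableTypeR R) A +
                 (2^-1 * (1 - p%:num))%:E * \d_(a : measurableTypeR R) A)%E.
Proof. by rewrite /two_point measure_addE /= /mscale. Qed.

Let two_point_setT : two_point setT = 1%E.
Proof.
rewrite two_pointE !diracT !mule1 -EFinD.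
by congr EFin; rewrite -mulrDr addrACA subrr addr0 mulVf.
Qed.

HB.instance Definition _ :=
  @Measure_isProbability.Build _ _ _ two_point two_point_setT.

End two_point.

Section fourier.
Context {R : realType}.

(* The integral of e^(2 pi i t x), taken on real and imaginary parts. *)
Definition fourier_stieltjes (mu : probability (measurableTypeR R) R) (t : R) :
    R[i] :=
  Complex (\int[mu]_x cos (2 * pi * t * x))%R
          (\int[mu]_x sin (2 * pi * t * x))%R.

Definition bigO_infty (f : R -> R[i]) (g : R -> R) : Prop :=
  exists C T : R, forall t : R, T <= `|t| ->
    ComplexField.Normc.normc (f t) <= C * `|g t|.

Definition log2 (x : R) : R := ln x / ln 2.

(* For x >= 0 this is the smallest integer strictly larger than x. For x < 0 it
   is 1, so that it is always a positive integer. *)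
Definition next_int (x : R) : nat := (Num.truncn x).+1.

End fourier.

(* Main.v *)
Require Import Defs.
From mathcomp Require Import all_boot all_order all_algebra.
From mathcomp Require Import complex.
From mathcomp Require Import all_classical all_reals all_analysis.
From mathcomp Require Import measurable_realfun ring lra zify.

Set Implicit Arguments.
Unset Strict Implicit.
Unset Printing Implicit Defensive.

Import Order.TTheory GRing.Theory Num.Theory.
Import numFieldNormedType.Exports.

Local Open Scope classical_set_scope.
Local Open Scope ring_scope.

(** Write [a n = pi t / 2 ^ n]. Up to a unimodular constant the [n]-th measure of
the convolution has transform [cos (a n) - i phi(n) sin (a n)] at [t]; so the
modulus of the transform of [mu] at [t] is at most any partial product of the
numbers [factor (phi n) (a n)], each of which is at most [1]
([normc_fourier_infinite_convolution_le]).

If [phi] were zero, the identity [sin (2 a) = 2 sin a cos a] would telescope the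
product of the cosines: multiplied by the sine of the last angle, it is the sine
of the angle preceding the first one, divided by a power of [2]. With [phi] present the same
computation leaves an error at most [phi (n)] at step [n], but the errors of the
earlier steps have been halved since, so they add up to a geometric series and
the total error is at most [2 phi(m+1)] when the product starts at index [m+1]
([sin_mul_prod_factor_le]).

The product is stopped at the index where [a n] lies between [pi/4] and [pi/2],
so that the last sine is at least [1/2]; this is about [log2 |t|]. Starting it
halfway, at [m] about [log2 |t| / 2], gives the bound
[4 phi(m+1) + 2 / 2 ^ m] ([normc_fourier_dyadic_le]). Both parts follow with
the constant [1/2]: under the ratio condition of part (1), [phi] decays no faster
than [2 ^ -m] and the first term dominates; under that of part (2), it decays at
least as fast as [2 ^ -m], which is of order [|t| ^ (-1/2)]. *)

(** * Telescoping of cosine products *)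

(** The modulus of [cos a - i p sin a]. *)
Definition factor (R : realType) (p a : R) : R :=
  Num.sqrt (cos a ^+ 2 + (p * sin a) ^+ 2).

Lemma factor_ge0 (R : realType) (p a : R) : 0 <= factor p a.
Proof. exact: sqrtr_ge0. Qed.

Lemma factor_le1 (R : realType) (p a : R) : 0 <= p <= 1 -> factor p a <= 1.
Proof.
move=> /andP[p0 p1]; rewrite /factor -[leRHS]sqrtr1 ler_sqrt// exprMn.
rewrite -(cos2Dsin2 a) lerD2l ler_piMl ?sqr_ge0// expr_le1//.
Qed.

Lemma factor_le (R : realType) (p a : R) :
  0 <= p -> factor p a <= `|cos a| + p * `|sin a|.
Proof.
move=> p0; have h : 0 <= `|cos a| + p * `|sin a| by rewrite addr_ge0// mulr_ge0.
rewrite /factor -(ger0_norm h) -sqrtr_sqr ler_sqrt ?sqr_ge0//.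
rewrite sqrrD !exprMn !real_normK ?num_real// lerD2r lerDl.
by rewrite mulrn_wge0// mulr_ge0// mulr_ge0.
Qed.

Lemma prod_factor_itv (R : realType) (p a : nat -> R) (m n : nat) :
  (forall i, (m <= i)%N -> 0 <= p i <= 1) ->
  0 <= \prod_(m <= i < n) factor (p i) (a i) <= 1.
Proof.
move=> p01; rewrite big_nat; elim/big_ind : _.
- by rewrite ler01 lexx.
- by move=> u v /andP[u0 u1] /andP[v0 v1]; rewrite mulr_ge0//= mulr_ile1.
- by move=> i /andP[mi _]; rewrite factor_ge0 factor_le1// p01.
Qed.

(** The left side [u k] satisfies [u (k+1) <= u k / 2 + q]: the new factor is at
most [|cos a| + q |sin a|], and [|sin a cos a|] is half of the sine of the
previous, doubled angle, while the remaining term [q (sin a) ^ 2] is at most [q].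
The right side solves this recurrence. *)
Lemma sin_mul_prod_factor_le (R : realType) (p : nat -> R) (x q : R) (m k : nat) :
  (forall n, (m < n)%N -> 0 <= p n <= q) -> q <= 1 ->
  `|sin (x / 2 ^+ (m + k))| *
      \prod_(m <= i < m + k) factor (p i.+1) (x / 2 ^+ i.+1)
    <= (2 - 2 / 2 ^+ k) * q + `|sin (x / 2 ^+ m)| / 2 ^+ k.
Proof.
move=> pq q1; elim: k => [|k IH].
  by rewrite addn0 big_geq// expr0 !divr1 subrr mul0r add0r mulr1.
rewrite addnS big_nat_recr ?leq_addr//=.
have := @prod_factor_itv R (fun i => p i.+1) (fun i => x / 2 ^+ i.+1) m (m + k).
set P := \prod_(_ <= i < _) _ in IH * => /(_ _)/andP[i|P0 P1].
  by move=> mi; have /andP[-> /le_trans->] := pq i.+1 mi.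
set a := x / 2 ^+ (m + k).+1; set s := `|sin (x / 2 ^+ m)| in IH *.
have Ha : x / 2 ^+ (m + k) = a *+ 2.
  by rewrite /a exprS -mulr_natl; field; rewrite expf_neq0.
rewrite Ha sin_mulr2n normrMn normrM in IH.
have /andP[p0 pleq] := pq (m + k).+1 (leq_addr _ _).
have F := factor_le a p0.
have s1 : `|sin a| <= 1 by rewrite ler_norml sin_geN1 sin_le1.
have s0 := normr_ge0 (sin a).
set f := factor _ _ in F *; set u := `|sin a| in IH F s1 s0 *.
set c := `|cos a| in IH F.
(* [h1] splits the new factor: its cosine part contributes half of the left side
   of [IH], and [h2] bounds the contribution of its sine part. *)
have h1 : u * (P * f) <= u * (P * (c + p (m + k).+1 * u)).
  by rewrite !ler_wpM2l.
have h2 : u * (P * (p (m + k).+1 * u)) <= q.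
  have -> : u * (P * (p (m + k).+1 * u)) = p (m + k).+1 * (P * (u * u)) by ring.
  rewrite (le_trans _ pleq)// ler_piMr// mulr_ile1// ?mulr_ge0//.
  by rewrite mulr_ile1.
have E2 : (2 ^+ k.+1)^-1 = (2 ^+ k)^-1 / 2 :> R by rewrite exprS invfM mulrC.
rewrite E2; move: IH h1 h2; set K := (2 ^+ k)^-1.
lra.
Qed.

Lemma sin_pi4_ge (R : realType) : 2^-1 <= sin (pi / 4) :> R.
Proof.
have p0 := @pi_gt0 R.
have s0 : 0 <= sin (pi / 4) :> R.
  by rewrite ltW// sin_gt0_pihalf//; apply/andP; split; lra.
have := @sin_pihalf R.
have -> : pi / 2 = (pi / 4 : R) *+ 2 by rewrite -mulr_natl; field.
rewrite sin_mulr2n => h; have c1 := cos_le1 (pi / 4 : R).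
have : cos (pi / 4) * sin (pi / 4) <= sin (pi / 4) :> R by rewrite ler_piMl.
lra.
Qed.

Lemma sin_ge_half (R : realType) (a : R) : pi / 4 <= a <= pi / 2 -> 2^-1 <= sin a.
Proof.
move=> /andP[a1 a2]; have p0 := @pi_gt0 R.
apply: (le_trans (@sin_pi4_ge R)).
rewrite leNgt ltr_sin ?in_itv/= -?leNgt//; apply/andP; split; lra.
Qed.

(** * Convolution with a two-point measure *)

Section convolution_two_point.
Variables (R : realType).
Implicit Types (mu : probability (measurableTypeR R) R).
Implicit Types (f : measurableTypeR R -> R).

Lemma bounded_integrable mu f (M : R) :
  measurable_fun setT f ->
  (forall x, `|f x| <= M) -> mu.-integrable setT (EFin \o f).
Proof.
move=> mf fM; apply: measurable_bounded_integrable => //.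
  by rewrite [X in (X < _)%E](probability_setT mu) ltry.
exists M; split; first by rewrite num_real.
by move=> y My x _; apply: (le_trans (fM x)); exact: ltW.
Qed.

Lemma ge0_integral_two_point (p : {itv R & `]0, 1[}) (a : R) f :
  measurable_fun setT f ->
  (forall x, 0 <= f x) ->
  (\int[two_point p a]_x (f x)%:E)%E =
  (2^-1 * (1 + p%:num) * f 0 + 2^-1 * (1 - p%:num) * f a)%:E.
Proof.
move=> mf f0; have /measurable_EFinP mEf := mf.
rewrite /two_point ge0_integral_measure_add//; last by move=> x _; rewrite lee_fin.
rewrite !ge0_integral_mscale//; try by move=> x _; rewrite lee_fin.
by rewrite !integral_dirac// !diracT !mul1e.
Qed.

Lemma ge0_integral_convolution_two_point mu (p : {itv R & `]0, 1[}) (a : R) f :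
  measurable_fun setT f ->
  (forall x, 0 <= f x) ->
  (\int[convolution mu (two_point p a)]_x (f x)%:E)%E =
  (\int[mu]_x (2^-1 * (1 + p%:num) * f x + 2^-1 * (1 - p%:num) * f (x + a))%:E)%E.
Proof.
move=> mf f0; rewrite /convolution ge0_integral_distribution; last 2 first.
- exact/measurable_EFinP.
- by move=> x; rewrite lee_fin.
rewrite fubini_tonelli1/=; last 2 first.
- by apply/measurable_EFinP; apply: measurableT_comp => //; exact: measurable_funD.
- by move=> x; rewrite lee_fin.
apply: eq_integral => x _; rewrite /fubini_F/= /addRR/=.
rewrite (@ge0_integral_two_point p a (fun y => f (x + y)))//= ?addr0//.
by apply: measurableT_comp => //; apply: measurable_funD.
Qed.

(** Tonelli's theorem gives this for nonnegative functions; the bounded function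
[f] is made nonnegative by adding [M], which adds [M] to both sides since the
weights sum to [1]. *)
Lemma Rintegral_convolution_two_point mu (p : {itv R & `]0, 1[}) (a M : R) f :
  measurable_fun setT f -> (forall x, `|f x| <= M) ->
  (\int[convolution mu (two_point p a)]_x f x)%R =
  2^-1 * (1 + p%:num) * (\int[mu]_x f x)%R +
  2^-1 * (1 - p%:num) * (\int[mu]_x f (x + a))%R.
Proof.
move=> mf fM.
have intD (nu : probability (measurableTypeR R) R) (g : measurableTypeR R -> R) :
    nu.-integrable setT (EFin \o g) ->
    (\int[nu]_x (g x + M) = \int[nu]_x g x + M)%R.
  move=> ig; rewrite RintegralD//.
    by rewrite Rintegral_cst// [X in fine X](probability_setT nu) mulr1.
  by apply: (@bounded_integrable _ (fun=> M) `|M|).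
have mfa : measurable_fun setT (fun x : measurableTypeR R => f (x + a)).
  by apply: measurableT_comp => //; apply: measurable_funD.
have faM x : `|f (x + a)| <= M by [].
have if1 := bounded_integrable mu mf fM.
have if2 := bounded_integrable mu mfa faM.
apply: (addIr M); rewrite -intD; last exact: bounded_integrable fM.
have p0 : 0 <= 2^-1 * (1 + p%:num) by rewrite mulr_ge0 ?invr_ge0 ?addr_ge0.
have p1 : 0 <= 2^-1 * (1 - p%:num).
  by rewrite mulr_ge0 ?invr_ge0// subr_ge0.
have fM0 x : 0 <= f x + M.
  by have := fM x; rewrite ler_norml => /andP[]; rewrite -subr_ge0 opprK.
rewrite /Rintegral ge0_integral_convolution_two_point//; last first.
  exact: measurable_funD.
have iK c (g : measurableTypeR R -> R) : mu.-integrable setT (EFin \o g) ->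
    mu.-integrable setT (EFin \o (fun x => c * g x)).
  by move=> ig; exact: (integrableZl measurableT c ig).
transitivity (\int[mu]_x ((2^-1 * (1 + p%:num) * f x +
    2^-1 * (1 - p%:num) * f (x + a)) + M))%R.
  by congr fine; apply: eq_integral => x _ /=; congr EFin; field.
rewrite intD ?RintegralD ?RintegralZl//; try exact: iK.
exact: (integrableD measurableT (iK _ _ if1) (iK _ _ if2)).
Qed.

End convolution_two_point.

(** * The transform as an infinite product *)

Section fourier_convolution.
Variables (R : realType).
Implicit Types (mu : probability (measurableTypeR R) R).

Let continuous_mull (s : R) : continuous (fun x : R => s * x).
Proof. by move=> x; apply: cvgM; [exact: cvg_cst|exact: cvg_id]. Qed.

Lemma continuous_cos_mull (s : R) : continuous (fun x : R => cos (s * x)).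
Proof.
by move=> x; apply: continuous_comp; [exact: continuous_mull|exact: continuous_cos].
Qed.

Lemma continuous_sin_mull (s : R) : continuous (fun x : R => sin (s * x)).
Proof.
by move=> x; apply: continuous_comp; [exact: continuous_mull|exact: continuous_sin].
Qed.

Lemma normr_cos_le1 (x : R) : `|cos x| <= 1.
Proof. by rewrite ler_norml cos_geN1 cos_le1. Qed.

Lemma normr_sin_le1 (x : R) : `|sin x| <= 1.
Proof. by rewrite ler_norml sin_geN1 sin_le1. Qed.

(** With [b = pi t a], the two-point measure has transform
[(1 + p) / 2 + (1 - p) / 2 * exp (2 i b) = exp (i b) (cos b - i p sin b)]. *)
Lemma normc_fourier_convolution_two_point mu (p : {itv R & `]0, 1[}) (a t : R) :
  ComplexField.Normc.normc (fourier_stieltjes (convolution mu (two_point p a)) t) =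
  ComplexField.Normc.normc (fourier_stieltjes mu t) * factor p%:num (pi * t * a).
Proof.
rewrite /fourier_stieltjes /ComplexField.Normc.normc.
set s := 2 * pi * t.
have mcos : measurable_fun setT (fun x : measurableTypeR R => cos (s * x)).
  exact: continuous_measurable_fun (@continuous_cos_mull s).
have msin : measurable_fun setT (fun x : measurableTypeR R => sin (s * x)).
  exact: continuous_measurable_fun (@continuous_sin_mull s).
have icos := bounded_integrable mu mcos (fun x => normr_cos_le1 (s * x)).
have isin := bounded_integrable mu msin (fun x => normr_sin_le1 (s * x)).
have iK c (g : measurableTypeR R -> R) : mu.-integrable setT (EFin \o g) ->
    mu.-integrable setT (EFin \o (fun x => c * g x)).
  by move=> ig; exact: (integrableZl measurableT c ig).
rewrite (Rintegral_convolution_two_point mu p a mcos (fun x => normr_cos_le1 _)).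
rewrite (Rintegral_convolution_two_point mu p a msin (fun x => normr_sin_le1 _)).
set C := (\int[mu]_x cos (s * x))%R; set S := (\int[mu]_x sin (s * x))%R.
have -> : (\int[mu]_x cos (s * (x + a)) = cos (s * a) * C - sin (s * a) * S)%R.
  rewrite -!RintegralZl// -RintegralB//; try exact: iK.
  by congr fine; apply: eq_integral => x _; rewrite mulrDr cosD; congr EFin; ring.
have -> : (\int[mu]_x sin (s * (x + a)) = cos (s * a) * S + sin (s * a) * C)%R.
  rewrite -!RintegralZl// -RintegralD//; try exact: iK.
  by congr fine; apply: eq_integral => x _; rewrite mulrDr sinD; congr EFin; ring.
have -> : s * a = (pi * t * a) *+ 2 by rewrite -mulr_natl /s; ring.
rewrite /factor -sqrtrM ?addr_ge0 ?sqr_ge0//; congr Num.sqrt.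
rewrite sin_mulr2n cos_mulr2n; set c := cos _; set z := sin _.
have h : c ^+ 2 = 1 - z ^+ 2 by exact: cos2sin2.
have -> : c ^+ 2 *+ 2 - 1 = 1 - z ^+ 2 *+ 2 by rewrite h; ring.
set q := p%:num.
(* Both sides are [(C ^+ 2 + S ^+ 2) * (1 - (1 - q ^+ 2) * z ^+ 2)]; the
   intermediate form is the left side before [c] is eliminated. *)
transitivity ((C ^+ 2 + S ^+ 2) *
  ((1 - (1 - q) * z ^+ 2) ^+ 2 + (1 - q) ^+ 2 * c ^+ 2 * z ^+ 2)).
  by field.
by rewrite exprMn h; ring.
Qed.

Lemma normc_fourier_finite_convolution (p : nat -> {itv R & `]0, 1[}) (t : R)
    (N : nat) :
  ComplexField.Normc.normc
    (fourier_stieltjes (finite_convolution (fun n => two_point (p n) (2 ^- n)) N) t) =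
  \prod_(0 <= i < N) factor (p i.+1)%:num (pi * t / 2 ^+ i.+1).
Proof.
elim: N => [|N IH].
  rewrite big_geq// /fourier_stieltjes /= /Rintegral.
  have mcos : measurable_fun setT
      (fun x : measurableTypeR R => cos (2 * pi * t * x)).
    exact: continuous_measurable_fun (@continuous_cos_mull (2 * pi * t)).
  have msin : measurable_fun setT
      (fun x : measurableTypeR R => sin (2 * pi * t * x)).
    exact: continuous_measurable_fun (@continuous_sin_mull (2 * pi * t)).
  rewrite !integral_dirac//; [|exact/measurable_EFinP..].
  by rewrite !diracT !mul1e/= mulr0 cos0 sin0 expr0n addr0 expr1n sqrtr1.
by rewrite big_nat_recr// -IH; exact: normc_fourier_convolution_two_point.
Qed.

(** All factors outside the window from [m] to [n] are at most [1], so the bound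
holds for the finite convolutions of length at least [n]; it passes to the weak
limit because [cos] and [sin] are continuous and bounded. *)
Lemma normc_fourier_infinite_convolution_le (p : nat -> {itv R & `]0, 1[}) mu
    (t : R) (m n : nat) : (m <= n)%N ->
  is_infinite_convolution (fun n => two_point (p n) (2 ^- n)) mu ->
  ComplexField.Normc.normc (fourier_stieltjes mu t) <=
  \prod_(m <= i < n) factor (p i.+1)%:num (pi * t / 2 ^+ i.+1).
Proof.
move=> mn muP; set B := \prod_(_ <= i < _) _.
have P01 u v : 0 <= \prod_(u <= i < v)
    factor (p i.+1)%:num (pi * t / 2 ^+ i.+1) <= 1.
  apply: (@prod_factor_itv R (fun i => (p i.+1)%:num)
    (fun i => pi * t / 2 ^+ i.+1)) => i _.
  by apply/andP.
have /andP[B0 _] := P01 m n.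
have nearB : \forall N \near \oo, ComplexField.Normc.normc (fourier_stieltjes
    (finite_convolution (fun n => two_point (p n) (2 ^- n)) N) t) ^+ 2 <= B ^+ 2.
  near=> N; have nN : (n <= N)%N by near: N; exact: nbhs_infty_ge.
  rewrite normc_fourier_finite_convolution lerXn2r ?nnegrE//.
    by have /andP[] := P01 0 N.
  rewrite (big_cat_nat _ (n := n))//= (big_cat_nat _ (n := m) (p := n))//= -/B.
  have /andP[A0 A1] := P01 0 m; have /andP[D0 D1] := P01 n N.
  by rewrite (le_trans (ler_piMr _ D1)) ?mulr_ge0// ler_piMl.
have bC : exists M, forall x, `|cos (2 * pi * t * x)| <= M.
  by exists 1 => x; exact: normr_cos_le1.
have bS : exists M, forall x, `|sin (2 * pi * t * x)| <= M.
  by exists 1 => x; exact: normr_sin_le1.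
have cC := muP _ (@continuous_cos_mull (2 * pi * t)) bC.
have cS := muP _ (@continuous_sin_mull (2 * pi * t)) bS.
rewrite -[leRHS](ger0_norm B0) -[leRHS]sqrtr_sqr /fourier_stieltjes /=.
rewrite ler_sqrt ?sqr_ge0//.
pose nu := finite_convolution (fun n => two_point (p n) (2 ^- n)).
have cCS : ((\int[nu N]_x cos (2 * pi * t * x))%R ^+ 2 +
    (\int[nu N]_x sin (2 * pi * t * x))%R ^+ 2) @[N --> \oo] -->
    (\int[mu]_x cos (2 * pi * t * x))%R ^+ 2 +
    (\int[mu]_x sin (2 * pi * t * x))%R ^+ 2.
  by apply: cvgD; rewrite expr2; apply: cvgM.
rewrite -(cvg_lim (@Rhausdorff R) cCS); apply: limr_le.
  by apply/cvg_ex; eexists; exact: cCS.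
near=> N; have : ComplexField.Normc.normc (fourier_stieltjes
    (finite_convolution (fun n => two_point (p n) (2 ^- n)) N) t) ^+ 2 <= B ^+ 2.
  by near: N.
by rewrite /fourier_stieltjes /= sqr_sqrtr// addr_ge0 ?sqr_ge0.
Unshelve. all: by end_near. Qed.

End fourier_convolution.

(** * Decay at infinity *)

(** The last angle of the product is at least [pi / 4], so dividing by its sine
costs a factor [2]; since [2 m <= r], the product is long enough for the
main term [2 ^ -k] to be at most [2 ^ -m]. *)
Lemma normc_fourier_dyadic_le (R : realType) (phi : nat -> {itv R & `]0, 1[})
    (mu : probability (measurableTypeR R) R) (t : R) (m r : nat) :
  (forall m n : nat, (0 < m)%N -> (m <= n)%N -> (phi n)%:num <= (phi m)%:num) ->
  is_infinite_convolution (fun n => two_point (phi n) (2 ^- n)) mu ->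
  2 ^+ r <= `|t| <= 2 ^+ r.+1 -> (m.*2 <= r)%N ->
  ComplexField.Normc.normc (fourier_stieltjes mu t)
    <= 4 * (phi m.+1)%:num + 2 * 2 ^- m.
Proof.
move=> phi_noninc muP /andP[t1 t2] mr.
(* The product runs over the indices [m + 1, ..., m + k = r + 2]: at the last one
   the angle [pi * |t| / 2 ^+ r.+2] lies between [pi / 4] and [pi / 2]. *)
have [k rk mk] : exists2 k, (r.+2 = m + k)%N & (m <= k)%N.
  by exists (r.+2 - m)%N; lia.
apply: (le_trans (normc_fourier_infinite_convolution_le t (leq_addr k m) muP)).
have phi_itv n : (m < n)%N -> 0 <= (phi n)%:num <= (phi m.+1)%:num.
  by move=> mn; rewrite phi_noninc// andbT.
have phi1 : (phi m.+1)%:num <= 1 by [].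
have := sin_mul_prod_factor_le (pi * t) k phi_itv phi1.
set P := \prod_(_ <= i < _) _ => H.
have P0 : 0 <= P by rewrite prodr_ge0// => i _; exact: factor_ge0.
have sin_ge : 2^-1 <= `|sin (pi * t / 2 ^+ (m + k))|.
  have -> : `|sin (pi * t / 2 ^+ (m + k))| = `|sin (pi * `|t| / 2 ^+ (m + k))|.
    by have [//|t0] := ger0P t; rewrite mulrN mulNr sinN normrN.
  apply: le_trans (ler_norm _); apply: sin_ge_half.
  have r0 : 0 < 2 ^+ r :> R by rewrite exprn_gt0.
  have := @pi_gt0 R; rewrite -rk => pi0; move: t2; rewrite !exprS => t2.
  rewrite ler_pdivlMr ?mulr_gt0// ler_pdivrMr ?mulr_gt0//; apply/andP; split.
    by have := ler_wpM2l (ltW pi0) t1; lra.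
  by have := ler_wpM2l (ltW pi0) t2; lra.
have s1 : `|sin (pi * t / 2 ^+ m)| / 2 ^+ k <= 2 ^- k.
  by rewrite ler_piMl ?invr_ge0 ?exprn_ge0// normr_sin_le1.
have k1 : 2 ^- k <= 2 ^- m :> R.
  by rewrite lef_pV2 ?posrE ?exprn_gt0// ler_weXn2l// ler1n.
have k0 : 0 <= 2 / 2 ^+ k * (phi m.+1)%:num.
  by rewrite !mulr_ge0// invr_ge0 exprn_ge0.
have := ler_wpM2r P0 sin_ge.
lra.
Qed.

Lemma truncn_log2_powR_itv (R : realType) (c t : R) : 0 <= c -> 1 <= t ->
  2 ^+ Num.truncn (c * log2 t) <= t `^ c <= 2 ^+ (Num.truncn (c * log2 t)).+1.
Proof.
move=> c0 t1; have t0 : 0 < t by exact: lt_le_trans t1.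
have ln2 : 0 < ln 2 :> R by rewrite ln_gt0// ltr1n.
have tE : t `^ c = 2 `^ (c * log2 t).
  by rewrite /log2 /powR gt_eqF// pnatr_eq0/= -mulrA divfK// gt_eqF.
have l0 : 0 <= c * log2 t by rewrite mulr_ge0// divr_ge0 ?ln_ge0// ?ler1n.
have /andP[n1 n2] := truncn_itv l0.
rewrite tE -!powR_mulrn// !ler_powR ?ler1n//; exact: ltW.
Qed.

Theorem theorem1p1 (R : realType) (phi : nat -> {itv R & `]0, 1[})
    (phi_noninc : forall m n : nat, (0 < m)%N -> (m <= n)%N ->
       (phi n)%:num <= (phi m)%:num)
    (phi_to0 : (phi n)%:num @[n --> \oo] --> (0 : R)) :
  ((forall n : nat, (0 < n)%N -> (phi n)%:num / (phi n.+1)%:num < 2) ->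
   exists gamma1 : R, 0 < gamma1 < 1 /\
     forall mu : probability (measurableTypeR R) R,
       is_infinite_convolution
         (fun n => two_point (phi n) (2 ^- n)) mu ->
       bigO_infty (fourier_stieltjes mu)
         (fun t => (phi (next_int (gamma1 * log2 `|t|)))%:num))
  /\
  ((forall n : nat, (0 < n)%N -> 2 <= (phi n)%:num / (phi n.+1)%:num) ->
   exists gamma2 : R, 0 < gamma2 < 1 /\
     forall mu : probability (measurableTypeR R) R,
       is_infinite_convolution
         (fun n => two_point (phi n) (2 ^- n)) mu ->
       bigO_infty (fourier_stieltjes mu)
         (fun t => `|t| `^ (- gamma2))).
Proof.
have bound (mu : probability (measurableTypeR R) R) (t : R) :
    is_infinite_convolution (fun n => two_point (phi n) (2 ^- n)) mu ->
    1 <= `|t| ->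
    ComplexField.Normc.normc (fourier_stieltjes mu t)
      <= 4 * (phi (Num.truncn (2^-1 * log2 `|t|)).+1)%:num
         + 2 * 2 ^- Num.truncn (2^-1 * log2 `|t|).
  move=> muP t1.
  apply: (normc_fourier_dyadic_le phi_noninc (r := Num.truncn (log2 `|t|)) muP).
    by have := truncn_log2_powR_itv (@ler01 R) t1; rewrite mul1r powRr1.
  have l0 : 0 <= log2 `|t|.
    by rewrite divr_ge0 ?ln_ge0// ler1n.
  rewrite truncn_ge_nat// -muln2 natrM.
  have l20 : 0 <= 2^-1 * log2 `|t| by rewrite mulr_ge0// invr_ge0.
  have /andP[m1 _] := truncn_itv l20.
  by move: m1; lra.
have half01 : 0 < (2^-1 : R) < 1 by apply/andP; split; lra.
split=> ratio; exists 2^-1; split=> // mu muP.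
(* Here [phi] at most halves at each step, so [2 ^- m] is bounded by a multiple
   of [phi m.+1]. *)
- have slow m : 2 ^- m <= (phi 1)%:num^-1 * (phi m.+1)%:num.
    elim: m => [|m IH]; first by rewrite expr0 invr1 mulVf.
    have := ratio m.+1 isT; rewrite ltr_pdivrMr// => /ltW h.
    have i0 : 0 <= (phi 1)%:num^-1 by rewrite invr_ge0.
    have := ler_wpM2l i0 h.
    rewrite exprS invfM; lra.
  exists (4 + 2 * (phi 1)%:num^-1), 1 => t t1.
  apply: (le_trans (bound _ _ muP t1)).
  rewrite /next_int; set m := Num.truncn (2^-1 * log2 `|t|).
  rewrite [`|(phi _)%:num|]ger0_norm//.
  by rewrite [leRHS]mulrDl lerD2l -mulrA ler_pM2l.
(* Here [phi] at least halves at each step, and [2 ^- m] is at most twice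
   [|t| ^ (-1/2)]. *)
- have fast m : (phi m.+1)%:num <= 2 ^- m.
    elim: m => [|m IH]; first by rewrite expr0 invr1.
    have := ratio m.+1 isT; rewrite ler_pdivlMr// => h.
    rewrite exprS invfM; lra.
  have lin (u v w : R) : u <= v -> v <= 2 * w -> 4 * u + 2 * v <= 12 * w by lra.
  exists 12, 1 => t t1; apply: (le_trans (bound _ _ muP t1)).
  set m := Num.truncn (2^-1 * log2 `|t|).
  have h0 : 0 <= 2^-1 :> R by rewrite invr_ge0.
  have /andP[_] := truncn_log2_powR_itv h0 t1; rewrite -/m => h.
  have tp : 0 < `|t| `^ 2^-1 by rewrite powR_gt0// (lt_le_trans ltr01).
  rewrite (ger0_norm (powR_ge0 _ _)) powRN.
  have tm : (2 ^+ m.+1)^-1 <= (`|t| `^ 2^-1)^-1.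
    by rewrite lef_pV2// posrE exprn_gt0.
  have {}tm : 2 ^- m <= 2 * (`|t| `^ 2^-1)^-1.
    by rewrite -ler_pdivrMl// -invfM -exprS.
  exact: (lin _ _ _ (fast m) tm).
Qed.
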